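(* For $n\ge 2$ let $f(n)$ be the maximum of $\sigma_t(G)/\sigma(G)$ over all connected non-regular graphs $G$ of order $n$ (defined for those $n$ for which such graphs exist, i.e. $n \ge 3$). Then $f(n)\le \sqrt{1.5}\, n^{5/2}$ for all such $n$, and $f(n)=\Omega(n^{5/2})$; hence $f(n)=\Theta(n^{5/2})$. In particular, every connected graph $G$ of order $n$ satisfies $\sigma_t(G)\le \sqrt{1.5}\,n^{5/2}\,\sigma(G)$, and there exist connected graphs for which $\sigma_t(G)/\sigma(G)\ge c\,n^{5/2}$ for some absolute constant $c>0$, for all sufficiently large $n$.
   Context: For a graph $G=(V,E)$ with vertex degrees $d(\cdot)$: $\sigma(G)=\sum_{uv\in E}(d(u)-d(v))^2$ (sum over edges) and $\sigma_t(G)=\sum_{\{u,v\}\subseteq V}(d(u)-d(v))^2$ (sum over all unordered pairs of distinct vertices). A connected graph is non-regular iff $\sigma(G)>0$. *)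

(* Defs.v *)
From mathcomp Require Import all_boot all_order all_algebra.
From mathcomp Require Import reals.
Set Implicit Arguments. Unset Strict Implicit. Unset Printing Implicit Defensive.
Import Order.TTheory GRing.Theory Num.Theory.
Local Open Scope ring_scope.

Definition simple_graph (n : nat) (e : rel 'I_n) : Prop :=
  symmetric e /\ irreflexive e.

Definition connected_graph (n : nat) (e : rel 'I_n) : Prop :=
  forall x y : 'I_n, connect e x y.

Definition deg (n : nat) (e : rel 'I_n) (x : 'I_n) : nat := #|[set y | e x y]|.

Definition sigma (R : realType) (n : nat) (e : rel 'I_n) : R :=
  \sum_(u : 'I_n) \sum_(v : 'I_n | ((u < v)%N && e u v))
     ((deg e u)%:R - (deg e v)%:R) ^+ 2.

Definition sigma_t (R : realType) (n : nat) (e : rel 'I_n) : R :=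
  \sum_(u : 'I_n) \sum_(v : 'I_n | (u < v)%N)
     ((deg e u)%:R - (deg e v)%:R) ^+ 2.

Definition pow52 (R : realType) (n : nat) : R := n%:R ^+ 2 * Num.sqrt (n%:R).

(* Main.v *)
(** Upper bound: let [D] be the gap between the extreme degrees. Since the
    [n * (n - 1) / 2] pairs contribute at most [n ^ 2 * D ^ 2 / 4] to [sigma_t],
    it suffices that [D ^ 4 <= 24 * n * sigma ^ 2]. Along a path joining the
    extreme degrees, integrality gives [D <= sigma]. On a geodesic every vertex
    of the graph has at most three neighbours, so the degrees sum to at most
    [3 * n]; hence few vertices precede the point where the degree has dropped
    by [2 * D / 3], and Cauchy-Schwarz gives [4 * D ^ 3 <= 81 * n * sigma].

    Lower bound: a path of at least [n / 2] vertices of degree 2 is followed by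
    cliques of sizes [4, 5, ..., 2 * a + 3], each deprived of one edge and
    chained through the ends of that edge, so that the degree is constant on
    each block and grows by one along each link. Then [sigma] is of order [a],
    and [sigma_t] of order [n * a ^ 2 * a ^ 2], where [a] is of order [sqrt n]. *)

Require Import Defs.
From mathcomp Require Import all_boot all_order all_algebra.
From mathcomp Require Import boolp reals.
From mathcomp Require Import zify ring lra.
Import Order.TTheory GRing.Theory Num.Theory.
Local Open Scope ring_scope.

(** * Geodesics and the degrees along them *)

Lemma sum_interval (n a b : nat) :
  (\sum_(k < n) (a <= k < b) = minn n b - minn n a)%N.
Proof.
elim: n => [|n IHn]; first by rewrite big_ord0; lia.
rewrite big_ord_recr /= IHn; case: (boolP (a <= n < b)%N) => /=; lia.
Qed.

(** A walk of minimal length from [u] into [A] works: stopping earlier in [A], cutting out a closed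
    stretch, or detouring through [z] would each shorten it. *)
Lemma exists_geodesic {T : finType} {e : rel T} {A : pred T} {u v : T} :
  connect e u v -> A v ->
  exists (m : nat) (x : nat -> T),
  [/\ x 0%N = u, A (x m), forall i, (i < m)%N -> ~~ A (x i),
      forall i, (i < m)%N -> e (x i) (x i.+1) &
      (forall i j, (i <= j <= m)%N -> x i = x j -> i = j) /\
      (forall i j z, (i <= j <= m)%N -> e (x i) z -> e z (x j) ->
         (j <= i + 2)%N)].
Proof.
move=> /connectP[p up vp] Av.
pose walk m (x : nat -> T) :=
  [/\ x 0%N = u, A (x m) & forall i, (i < m)%N -> e (x i) (x i.+1)].
have ex : exists m, `[< exists x, walk m x >].
  exists (size p); apply/asboolP; exists (nth u (u :: p)); split => //.
  - by rewrite nth_last /= -vp.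
  - by move=> i ip; have /pathP := up; apply.
have [m /asboolP[x [x0 Am xe]] mmin] := ex_minnP ex.
have shorter k y : walk k y -> (m <= k)%N.
  by move=> wy; apply: mmin; apply/asboolP; exists y.
exists m, x; split => //.
  move=> i im; apply/negP => Ai.
  have : (m <= i)%N by apply: (shorter _ x); split => // j ji; apply: xe; lia.
  lia.
split=> [i j ijm xij|i j z ijm eiz ezj].
  have : (m <= m - (j - i))%N.
    apply: (shorter _ (fun k => if (k <= i)%N then x k else x (k + (j - i))%N)).
    split => //=.
      case: leqP => mi; last by congr (A (x _)): Am; lia.
      have -> : (m - (j - i) = i)%N by lia.
      by rewrite xij; congr (A (x _)): Am; lia.
    move=> k km; case: (ltngtP k i) => ki.
    - apply: xe; lia.
    - have -> : (k.+1 + (j - i) = (k + (j - i)).+1)%N by lia.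
      apply: xe; lia.
    - rewrite ki xij; have -> : (i.+1 + (j - i) = j.+1)%N by lia.
      apply: xe; lia.
  lia.
rewrite leqNgt; apply/negP => ji.
have : (m <= m - (j - i - 2))%N.
  apply: (shorter _ (fun k => if (k <= i)%N then x k else
                       if k == i.+1 then z else x (k + (j - i - 2))%N)).
  split => //=.
    case: leqP => mi; first by lia.
    case: eqP => mi'; first by lia.
    by congr (A (x _)): Am; lia.
  move=> k km; case: (ltngtP k i) => ki.
  - apply: xe; lia.
  - have -> : (k.+1 == i.+1) = false by lia.
    case: eqP => ki'.
      have -> : (k.+1 + (j - i - 2) = j)%N by lia.
      by [].
    rewrite addSn; apply: xe; lia.
  - by rewrite ki eqxx.
lia.
Qed.

Lemma deg_sum (n : nat) (e : rel 'I_n) (x : 'I_n) :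
  deg e x = (\sum_(z < n) e x z)%N.
Proof. by rewrite /deg -sum1dep_card big_mkcond. Qed.

(** After exchanging the sums, each [z] counts its neighbours on the path; their indices lie between
    the first one, [k], and [k + 2]. *)
Lemma deg_sum_geodesic {n : nat} {e : rel 'I_n} {m : nat} {x : nat -> 'I_n} :
  (forall i j z, (i <= j <= m)%N -> e (x i) z -> e z (x j) -> (j <= i + 2)%N) ->
  symmetric e ->
  (\sum_(i < m) deg e (x i) <= 3 * n)%N.
Proof.
move=> geo sym.
under eq_bigr do rewrite deg_sum.
rewrite exchange_big /= mulnC.
have -> : (n * 3 = \sum_(z < n) 3)%N by rewrite sum_nat_const card_ord.
apply: leq_sum => z _.
have [/existsP[i0 ei0]|/existsPn none] := boolP [exists i : 'I_m, e (x i) z];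
  last by rewrite big1 // => i _; rewrite (negbTE (none i)).
have ex : exists k, (k < m)%N && e (x k) z by exists i0; rewrite ltn_ord.
have [k /andP[km ekz] kmin] := ex_minnP ex.
apply: (@leq_trans (\sum_(i < m) (k <= i < k + 3))%N); last by rewrite sum_interval; lia.
apply: leq_sum => i _; case: (boolP (e (x i) z)) => // eiz.
have ki : (k <= i)%N by apply: kmin; rewrite ltn_ord.
have := geo k i z; rewrite ki ekz sym eiz (ltnW (ltn_ord i)) => /(_ isT isT isT); lia.
Qed.

Lemma sum_sqr_path_le_sigma (R : realType) {n : nat} {e : rel 'I_n} {m : nat}
    {x : nat -> 'I_n} :
  simple_graph e ->
  (forall i, (i < m)%N -> e (x i) (x i.+1)) ->
  (forall i j, (i <= j <= m)%N -> x i = x j -> i = j) ->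
  \sum_(i < m) ((deg e (x i))%:R - (deg e (x i.+1))%:R) ^+ 2 <= sigma R e.
Proof.
move=> [sym irr] xe xinj.
have {}xinj i j : (i <= m)%N -> (j <= m)%N -> x i = x j -> i = j.
  move=> im jm; case: (leqP i j) => ij xij; first by apply: xinj; rewrite ?ij.
  by apply/esym/xinj; rewrite ?(ltnW ij).
pose F (q : 'I_n * 'I_n) : R := ((deg e q.1)%:R - (deg e q.2)%:R) ^+ 2.
(* [sigma] counts each edge once, from its smaller endpoint, so the path edges are oriented upwards.
   Injectivity of [x] makes these pairs distinct. *)
pose pr i := if (x i < x i.+1)%N then (x i, x i.+1) else (x i.+1, x i).
rewrite /sigma pair_big_dep /=.
rewrite [leRHS](_ : _ = \sum_(q : 'I_n * 'I_n | (q.1 < q.2)%N && e q.1 q.2) F q) //.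
have -> : \sum_(i < m) ((deg e (x i))%:R - (deg e (x i.+1))%:R) ^+ 2 =
    \sum_(q <- [seq pr i | i : 'I_m]) F q.
  rewrite big_map big_enum /=; apply: eq_bigr => i _.
  by rewrite /F /pr; case: ifP => _ //=; rewrite -sqrrN opprB.
have upr : uniq [seq pr i | i : 'I_m].
  rewrite map_inj_uniq ?enum_uniq // => i j; have := ltn_ord i; have := ltn_ord j.
  move=> jm im; rewrite /pr.
  case: ifP => _; case: ifP => _ [] /xinj h1 /xinj h2; apply: val_inj => /=; lia.
rewrite big_uniq //= [leRHS](bigID (mem [seq pr i | i : 'I_m])) /=.
rewrite -[leLHS]addr0 lerD //; last by apply: sumr_ge0 => q _; rewrite sqr_ge0.
rewrite le_eqVlt; apply/orP; left; apply/eqP/eq_bigl => q.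
case: (boolP (q \in _)) => [|_]; last by rewrite andbF.
move=> /mapP[i _ ->]; rewrite /pr; have im := ltn_ord i.
have ei := xe _ im.
case: (ltngtP (x i) (x i.+1)) => h /=; rewrite ?h ?[e (x i.+1) _]sym ?ei //.
by move: ei; rewrite (ord_inj h) irr.
Qed.

(** * Lagrange's identity, with Cauchy-Schwarz and Popoviciu's inequality as consequences *)

Lemma sum_sqrB {R : realDomainType} {I : finType} (a : I -> R) :
  \sum_i \sum_j (a i - a j) ^+ 2 =
  2 * (#|I|%:R * \sum_i a i ^+ 2 - (\sum_i a i) ^+ 2).
Proof.
have -> : \sum_i \sum_j (a i - a j) ^+ 2 =
    \sum_i (#|I|%:R * a i ^+ 2 + \sum_j a j ^+ 2 - 2 * a i * \sum_j a j).
  apply: eq_bigr => i _; rewrite (eq_bigr (fun j => a i ^+ 2 + a j ^+ 2 - 2 * a i * a j)).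
    by rewrite !big_split /= sumr_const -[_ ^+ 2 *+ _]mulr_natl sumrN -mulr_sumr.
  by move=> j _; ring.
rewrite !big_split /= sumr_const sumrN -mulr_suml -!mulr_sumr -[_ *+ #|_|]mulr_natl.
ring.
Qed.

Lemma sqr_sum_le {R : realDomainType} {m : nat} (a : 'I_m -> R) :
  (\sum_i a i) ^+ 2 <= m%:R * \sum_i a i ^+ 2.
Proof.
have : 0 <= \sum_i \sum_j (a i - a j) ^+ 2.
  by apply: sumr_ge0 => i _; apply: sumr_ge0 => j _; apply: sqr_ge0.
by rewrite sum_sqrB card_ord pmulr_rge0 // subr_ge0.
Qed.

(** After centring at the midpoint [c + D / 2], every value is at most [D / 2] in absolute value,
    and [sum_sqrB] concludes. *)
Lemma sum_sqrB_lt_le {R : realFieldType} {n : nat} {a : 'I_n -> R} {c D : R} :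
  (forall i, c <= a i <= c + D) ->
  4 * \sum_(i < n) \sum_(j : 'I_n | (i < j)%N) (a i - a j) ^+ 2 <= n%:R ^+ 2 * D ^+ 2.
Proof.
move=> aD; pose b i := a i - c - D / 2.
have halves : 2 * \sum_(i < n) \sum_(j : 'I_n | (i < j)%N) (a i - a j) ^+ 2 <=
    \sum_i \sum_j (b i - b j) ^+ 2.
  rewrite mulr_natl mulr2n [X in X + _](_ : _ =
    \sum_(i < n) \sum_(j : 'I_n | (i > j)%N) (a i - a j) ^+ 2).
    rewrite -big_split /=; apply: ler_sum => i _.
    rewrite [leRHS](bigID (fun j : 'I_n => (i > j)%N)) /=; apply: lerD.
      by apply: ler_sum => j _; rewrite le_eqVlt; apply/orP; left; apply/eqP; rewrite /b; ring.
    rewrite [leRHS](bigID (fun j : 'I_n => (i < j)%N)) /= -[leLHS]addr0; apply: lerD.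
      rewrite le_eqVlt; apply/orP; left; apply/eqP; apply: eq_big => j; first by lia.
      by move=> _; rewrite /b; ring.
    by apply: sumr_ge0 => j _; apply: sqr_ge0.
  under eq_bigr do rewrite big_mkcond.
  rewrite exchange_big /=; apply: eq_bigr => i _; rewrite -big_mkcond /=.
  by apply: eq_bigr => j _; ring.
have sqb : \sum_i b i ^+ 2 <= n%:R * (D ^+ 2 / 4).
  rewrite mulr_natl -[X in _ *+ X](card_ord n) -sumr_const; apply: ler_sum => i _.
  by have := aD i; rewrite /b => /andP[]; nra.
have nb : n%:R * (\sum_i b i ^+ 2) <= n%:R * (n%:R * (D ^+ 2 / 4)) by rewrite ler_wpM2l.
move: halves; rewrite sum_sqrB card_ord; have := sqr_ge0 (\sum_i b i); nra.
Qed.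

Lemma sum_path_diff {R : realDomainType} (f : nat -> R) (m : nat) :
  \sum_(i < m) (f i - f i.+1) = f 0%N - f m.
Proof.
elim: m => [|m IHm]; first by rewrite big_ord0 subrr.
by rewrite big_ord_recr /= IHm; ring.
Qed.

Lemma natrB_le_sqr {R : realDomainType} (a b : nat) :
  a%:R - b%:R <= (a%:R - b%:R) ^+ 2 :> R.
Proof.
case: (leqP a b) => ab.
  by rewrite (@le_trans _ _ 0) ?sqr_ge0 // subr_le0 ler_nat.
rewrite -natrB ?(ltnW ab) // -natrX ler_nat; nia.
Qed.

(** * The degree gap and the upper bound *)

Section DegreeGap.
Context {R : realType} {n : nat} {e : rel 'I_n} {u v : 'I_n}.
Hypotheses (simple : simple_graph e) (conn : connected_graph e).

(** Degree drops telescope along a path, and each, being an integer, is at most its square. *)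
Lemma deg_gap_le_sigma : (deg e u)%:R - (deg e v)%:R <= sigma R e.
Proof.
have [m [x [x0 /eqP xm _ xe [xinj _]]]] :=
  exists_geodesic (conn u v) (eqxx v : pred1 v v).
apply: le_trans (sum_sqr_path_le_sigma R simple xe xinj).
rewrite -{1}x0 -{1}xm -(sum_path_diff (fun i => (deg e (x i))%:R)).
by apply: ler_sum => i _; apply: natrB_le_sqr.
Qed.

(* The path is cut at the first vertex whose degree has lost two thirds of the
   gap: a longer path would only visit vertices of too small degree, and the
   degrees on a geodesic sum to at most [3 * n]. *)
Lemma deg_gap_cube : (deg e v <= deg e u)%N ->
  4 * ((deg e u)%:R - (deg e v)%:R) ^+ 3 <= 81 * n%:R * sigma R e.
Proof.
move=> vu; set D : R := _ - _.
pose A (z : 'I_n) := (3 * (deg e z - deg e v) <= deg e u - deg e v)%N.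
have Av : A v by rewrite /A subnn.
have [m [x [x0 Am Ai xe [xinj geo]]]] := exists_geodesic (conn u v) Av.
have [sym _] := simple.
have degs := deg_sum_geodesic geo sym.
have D0 : 0 <= D by rewrite subr_ge0 ler_nat.
have mD : m%:R * D <= 9 * n%:R.
  rewrite /D -natrB // -!natrM ler_nat.
  apply: (@leq_trans (3 * \sum_(i < m) deg e (x i))%N); last by lia.
  rewrite -{1}[m]card_ord -sum_nat_const big_distrr /=; apply: leq_sum => i _.
  by have := Ai i (ltn_ord i); rewrite /A; lia.
have drop : 2 * D <= 3 * ((deg e u)%:R - (deg e (x m))%:R).
  have : (2 * (deg e u - deg e v) + 3 * deg e (x m) <= 3 * deg e u)%N.
    by move: Am; rewrite /A; lia.
  by rewrite -(ler_nat R) natrD !natrM natrB // /D; lra.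
have cs := sqr_sum_le (fun i : 'I_m => (deg e (x i))%:R - (deg e (x i.+1))%:R : R).
rewrite (sum_path_diff (fun i => (deg e (x i))%:R)) x0 in cs.
have ps := sum_sqr_path_le_sigma R simple xe xinj.
set s := sigma R e in ps *.
have s0 : 0 <= s by apply: le_trans ps; apply: sumr_ge0 => i _; apply: sqr_ge0.
set q : R := (deg e u)%:R - _ in cs drop.
have q1 : q ^+ 2 <= m%:R * s by apply: le_trans cs _; rewrite ler_wpM2l.
have q2 : 4 * D ^+ 2 <= 9 * q ^+ 2 by nra.
(* Cauchy-Schwarz leaves the unknown length [m]; multiplying by [D] brings in [m * D], which is at
   most [9 * n]. *)
have q3 : D * (4 * D ^+ 2) <= D * (9 * (m%:R * s)) by rewrite ler_wpM2l //; lra.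
have q4 : s * (m%:R * D) <= s * (9 * n%:R) by rewrite ler_wpM2l.
rewrite exprS; lra.
Qed.

End DegreeGap.

Lemma sigma_ge0 (R : realType) (n : nat) (e : rel 'I_n) : 0 <= sigma R e.
Proof. by apply: sumr_ge0 => u _; apply: sumr_ge0 => v _; apply: sqr_ge0. Qed.

Lemma sigma_t_le (R : realType) (n : nat) (e : rel 'I_n) :
  simple_graph e -> connected_graph e ->
  sigma_t R e <= Num.sqrt (3 / 2) * pow52 R n * sigma R e.
Proof.
move=> simple conn.
case: n e simple conn => [|n] e simple conn.
  by rewrite /sigma_t /sigma !big_ord0 mulr0.
pose u := [arg max_(i > ord0) deg e i]; pose v := [arg min_(i < ord0) deg e i].
have umax i : (deg e i <= deg e u)%N by rewrite /u; case: arg_maxnP => // k _; apply.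
have vmin i : (deg e v <= deg e i)%N by rewrite /v; case: arg_minnP => // k _; apply.
have := @deg_gap_cube R _ _ u v simple conn (umax v).
have := @deg_gap_le_sigma R _ _ u v simple conn.
set D : R := _ - _; set s := sigma R e => Ds D3.
have D0 : 0 <= D by rewrite subr_ge0 ler_nat.
have s0 : 0 <= s := sigma_ge0 R _ e.
have st : 4 * sigma_t R e <= n.+1%:R ^+ 2 * D ^+ 2.
  apply: (@sum_sqrB_lt_le _ _ _ (deg e v)%:R) => i.
  by rewrite /D addrC subrK !ler_nat vmin umax.
have N0 : 0 <= n.+1%:R :> R by [].
set N : R := n.+1%:R in D3 st N0 *.
(* Multiplying the two bounds on the gap gives [4 * D ^ 4 <= 81 * N * s ^ 2]; the square of the
   right-hand side here is [24 * N * s ^ 2], and [81 / 4 <= 24]. *)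
have D2 : D ^+ 2 <= 4 * (Num.sqrt (3 / 2) * Num.sqrt N) * s.
  rewrite -(@ler_pXn2r _ 2) ?nnegrE ?sqr_ge0 ?mulr_ge0 ?sqrtr_ge0 //.
  rewrite !exprMn !sqr_sqrtr ?divr_ge0 //.
  have : D * (4 * D ^+ 3) <= s * (81 * N * s).
    by apply: ler_pM => //; rewrite mulr_ge0 // exprn_ge0.
  have : 0 <= N * s ^+ 2 by rewrite mulr_ge0 // sqr_ge0.
  by lra.
have NN := ler_wpM2l (sqr_ge0 N) D2.
by rewrite /pow52 -/N; lra.
Qed.

(** * Layout of the path and the blocks *)

Definition block_start (i : nat) : nat := (\sum_(j < i) (j + 4))%N.

Lemma block_startE (i : nat) : (2 * block_start i = i * (i + 7))%N.
Proof.
elim: i => [|i IHi]; first by rewrite /block_start big_ord0.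
by rewrite /block_start big_ord_recr /= -/(block_start i); lia.
Qed.

Lemma block_startS (i : nat) : block_start i.+1 = (block_start i + i + 4)%N.
Proof. by rewrite /block_start big_ord_recr /= addnA. Qed.

Lemma ltn_block_start {i j : nat} :
  (i < j)%N -> (block_start i + i + 4 <= block_start j)%N.
Proof. by move=> ij; have := block_startE i; have := block_startE j; nia. Qed.

Lemma ex_block (q : nat) : exists i, (q < block_start i.+1)%N.
Proof. by exists q; have := block_startE q.+1; nia. Qed.

Definition block (q : nat) : nat := ex_minn (ex_block q).

Lemma blockP (q : nat) :
  (block_start (block q) <= q < block_start (block q).+1)%N.
Proof.
rewrite /block; case: ex_minnP => -[|i] -> min; rewrite andbT.
  by rewrite /block_start big_ord0.
by rewrite leqNgt; apply/negP => /min; rewrite ltnn.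
Qed.

Lemma block_unique {i q : nat} :
  (block_start i <= q < block_start i.+1)%N -> block q = i.
Proof.
move=> qi; have := blockP q; move: qi.
by case: (ltngtP i (block q)) => [/ltn_block_start|/ltn_block_start|//];
  rewrite !block_startS; lia.
Qed.

(* The vertices [p < r] form a path; the block [i] that follows has [i + 4]
   vertices and is a clique minus the edge between its first and last vertex,
   which are instead joined to the neighbouring blocks. In every case, the
   neighbourhood of [p] is an interval [lo, hi) deprived of [p]. *)
Definition lo (r p : nat) : nat :=
  if (p < r)%N then p.-1 else
  let s := (r + block_start (block (p - r)))%N in
  let t := (r + block_start (block (p - r)).+1)%N in
  if p == s then s.-1 else if p.+1 == t then s.+1 else s.

Definition hi (r p : nat) : nat :=
  if (p < r)%N then p.+2 else
  let s := (r + block_start (block (p - r)))%N in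
  let t := (r + block_start (block (p - r)).+1)%N in
  if p == s then t.-1 else if p.+1 == t then t.+1 else t.

(** The intended degree: the actual one falls short, by one, only at the two ends of the finite
    graph. *)
Definition width (r p : nat) : nat :=
  if (p < r)%N then 2%N else (block (p - r) + 3)%N.

Definition adj (r u v : nat) : bool := (u != v) && (lo r u <= v < hi r u)%N.

(** Makes the three functions linear in [p], [i] and [block_start i], so that adjacency questions
    reduce to case analysis and [lia]. *)
Variant vertex_spec (r p : nat) : nat -> nat -> nat -> Prop :=
  | PathVertex of (p < r)%N : vertex_spec r p p.-1 p.+2 2%N
  | BlockFirst i of p = (r + block_start i)%N :
    vertex_spec r p p.-1 (p + i + 3) (i + 3)
  | BlockLast i of p = (r + block_start i + i + 3)%N :
    vertex_spec r p (p - i - 2) p.+2 (i + 3)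
  | BlockInner i s of s = (r + block_start i)%N & (s < p < s + i + 3)%N :
    vertex_spec r p s (s + i + 4) (i + 3).

Lemma vertexP (r p : nat) : vertex_spec r p (lo r p) (hi r p) (width r p).
Proof.
rewrite /lo /hi /width; case: ltnP => pr; first exact: PathVertex.
have := blockP (p - r); rewrite !block_startS.
move: (block _) => i ip.
have -> : (r + (block_start i + i + 4) = r + block_start i + i + 4)%N by lia.
case: eqP => ps.
  have -> : (r + block_start i + i + 4).-1 = (p + i + 3)%N by lia.
  rewrite -ps; exact: BlockFirst.
case: eqP => pt; last by apply: BlockInner; lia.
have -> : (r + block_start i + i + 4).+1 = p.+2 by lia.
have -> : (r + block_start i).+1 = (p - i - 2)%N by lia.
by apply: BlockLast; lia.
Qed.

(** [block_start] is quadratic, out of reach of [lia]; these linear facts tell apart equal,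
    consecutive and more distant blocks. *)
Lemma block_start_gap (i j : nat) :
  [\/ i = j, j = i.+1 /\ block_start j = (block_start i + i + 4)%N |
      (block_start i + i + 5 <= block_start j)%N] \/
  (i = j.+1 /\ block_start i = (block_start j + j + 4)%N) \/
  (block_start j + j + 5 <= block_start i)%N.
Proof.
have step k l : (k < l)%N ->
    l = k.+1 /\ block_start l = (block_start k + k + 4)%N \/
    (block_start k + k + 5 <= block_start l)%N.
  rewrite leq_eqVlt => /orP[/eqP <-|/ltn_block_start]; first by left; rewrite block_startS.
  by rewrite block_startS; right; lia.
case: (ltngtP i j) => [/step[]|/step[]|] h.
- by left; constructor 2.
- by left; constructor 3.
- by right; left.
- by right; right.
- by left; constructor 1.
Qed.

Lemma block_start_eq0 (i : nat) : i = 0%N \/ (4 <= block_start i)%N.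
Proof. by have := block_startE i; nia. Qed.

Lemma adj_sym (r : nat) : (0 < r)%N -> symmetric (adj r).
Proof.
move=> r0 u v; rewrite /adj eq_sym; congr andb; have T0 := block_startE 0%N.
case: (vertexP r u) => [ur|i eu|i eu|i s es us];
  case: (vertexP r v) => [vr|j ev|j ev|j t et vt]; try lia;
  try (case: (block_start_eq0 j) => [j0|]; first (subst j); lia);
  try (case: (block_start_eq0 i) => [i0|]; first (subst i); lia);
  case: (block_start_gap i j) => [[ij|[ij]|]|[[ij]|]]; try subst i; try subst j; lia.
Qed.

Lemma adj_width {r u v : nat} : (u < v)%N -> adj r u v ->
  width r u = width r v \/ v = u.+1 /\ width r v = (width r u).+1.
Proof.
rewrite /adj; have T0 := block_startE 0%N.
case: (vertexP r u) => [ur|i eu|i eu|i s es us];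
  case: (vertexP r v) => [vr|j ev|j ev|j t et vt]; try lia;
  try (case: (block_start_eq0 j) => [j0|]; first (subst j); lia);
  case: (block_start_gap i j) => [[ij|[ij]|]|[[ij]|]]; try subst i; try subst j; lia.
Qed.

Lemma adj_path (r p : nat) : adj r p p.+1.
Proof. by rewrite /adj; case: (vertexP r p); lia. Qed.

Lemma width_le (r : nat) : {homo width r : p q / (p <= q)%N}.
Proof.
move=> p q; case: (vertexP r p) => [pr|i ep|i ep|i s es ps];
  case: (vertexP r q) => [qr|j eq|j eq|j t et qt]; try lia;
  by case: (ltngtP i j) => [|/ltn_block_start|]; lia.
Qed.

(** Only an inequality, because [k] may fall outside the range of summation. *)
Lemma sum_delta_le (n k : nat) (f : nat -> nat) :
  (\sum_(u < n) (u == k :> nat) * f u <= f k)%N.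
Proof.
have -> : (\sum_(u < n) (u == k :> nat) * f u = (\sum_(u < n) (k <= u < k.+1)) * f k)%N.
  rewrite big_distrl /=; apply: eq_bigr => u _; rewrite [X in X == _]/= ltnS -eqn_leq eq_sym.
  by case: eqP => // ->.
by rewrite sum_interval; nia.
Qed.

(** * Degrees, [sigma] and [sigma_t] of the block graph *)

Section BlockGraph.
Context {r K : nat}.
Hypothesis r2 : (2 <= r)%N.
Let n := (r + block_start K.+1)%N.

Definition block_graph : rel 'I_n := fun u v => adj r u v.

Lemma block_graph_simple : simple_graph block_graph.
Proof.
split=> [u v|u]; first by apply: adj_sym; lia.
by rewrite /block_graph /adj eqxx.
Qed.

Lemma block_graph_connected : connected_graph block_graph.
Proof.
have n0 : (0 < n)%N by rewrite /n; lia.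
have [sym _] := block_graph_simple.
have from0 p (pn : (p < n)%N) : connect block_graph (Ordinal n0) (Ordinal pn).
  elim: p pn => [|p IHp] pn; first by rewrite (_ : Ordinal pn = Ordinal n0) //; apply: val_inj.
  apply: (connect_trans (IHp (ltnW pn))); apply: connect1; exact: adj_path.
move=> [x xn] [y yn]; apply: connect_trans (from0 y yn).
by rewrite (sym_connect_sym sym) from0.
Qed.

Lemma block_graph_deg (u : 'I_n) :
  (deg block_graph u + (u == 0%N :> nat) + (u.+1 == n) = width r u)%N.
Proof.
have un := ltn_ord u; rewrite deg_sum.
(* Adding [u] itself fills the interval [[lo, hi)]. One unit is lost at 0, where [0.-1 = 0], and one
   at the last vertex, where [hi] exceeds [n]. *)
have : (\sum_(z < n) block_graph u z + \sum_(z < n) (u <= z < u.+1) =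
        \sum_(z < n) (lo r u <= z < hi r u))%N.
  rewrite -big_split /=; apply: eq_bigr => z _; rewrite /block_graph /adj.
  have [->|uz] := eqVneq u z; last first.
    by have : (u : nat) != z by []; lia.
  by case: (vertexP r z); lia.
have en : n = (r + block_start K + K + 4)%N by rewrite /n block_startS; lia.
rewrite !sum_interval; move: (bigop _ _ _) => S; move: (nat_of_ord u) un => {}u un.
case: (vertexP r u) => [ur|i eu|i eu|i s es us]; first by lia.
all: by case: (block_start_gap i K) => [[ij|[ij]|]|[[ij]|]]; try subst i; lia.
Qed.

(** Adjacent degrees differ by at most one, and only on a link, at the first vertex or at the last
    one; the three terms charge these cases in turn. *)
Lemma block_graph_sqr_le (R : realType) (u v : 'I_n) :
  (u < v)%N -> block_graph u v ->
  ((deg block_graph u)%:R - (deg block_graph v)%:R) ^+ 2 <=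
  ((v == u.+1 :> nat) * (width r u.+1 - width r u) +
   (u == 0%N :> nat) * block_graph u v +
   (v == n.-1 :> nat) * block_graph v u)%N%:R :> R.
Proof.
move=> uv euv; have [sym _] := block_graph_simple.
have := block_graph_deg u; have := block_graph_deg v; rewrite [block_graph v u]sym euv.
have un := ltn_ord u; have vn := ltn_ord v.
have n2 : (5 < n)%N by rewrite /n block_startS; lia.
have w0 : width r 0 = 2%N by rewrite /width; case: ltnP => //; lia.
have w1 : width r 1 = 2%N by rewrite /width; case: ltnP => //; lia.
move=> dv du; set B := (_ + _ + _)%N.
have [->|[dB B1]] : deg block_graph u = deg block_graph v \/
    (deg block_graph u <= (deg block_graph v).+1 /\
     deg block_graph v <= (deg block_graph u).+1)%N /\ (1 <= B)%N.
- rewrite /B; case: (adj_width uv euv) => [wuv|[vu wuv]].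
    case: (posnP u) => [u0|u0].
      have : (v < 2)%N by move: euv; rewrite /block_graph /adj u0 /hi (_ : (0 < r)%N = true); lia.
      by rewrite u0 in du wuv *; lia.
    by case: (eqVneq v.+1 n) => vn'; lia.
  have wu : (width r u.+1 = (width r u).+1) by rewrite -vu.
  case: (posnP u) => [u0|u0]; first by move: wu; rewrite u0; lia.
  by case: (eqVneq v.+1 n) => vn'; lia.
- by rewrite subrr expr0n /= ler0n.
- move: dB => [d1 d2]; apply: (@le_trans _ _ 1); last by rewrite ler1n.
  move: d1 d2; rewrite -!(ler_nat R) -!natr1.
  by move: (_%:R) (_%:R) => x y; nra.
Qed.

(** Links contribute at most [K + 2] by telescoping, the edges at the first vertex at most 2, those
    at the last at most [K + 4]. *)
Lemma sigma_block_graph_le (R : realType) : sigma R block_graph <= (2 * K + 9)%N%:R.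
Proof.
have n0 : (5 < n)%N by rewrite /n block_startS; lia.
have w0 : width r 0 = 2%N by rewrite /width; case: ltnP => //; lia.
have degw u : (deg block_graph u <= width r u)%N by have := block_graph_deg u; lia.
rewrite /sigma.
apply: (@le_trans _ _ (\sum_(u < n) \sum_(v < n)
  ((v == u.+1 :> nat) * (width r u.+1 - width r u) +
   (u == 0%N :> nat) * block_graph u v +
   (v == n.-1 :> nat) * block_graph v u)%N)%N%:R).
  rewrite natr_sum; apply: ler_sum => u _; rewrite natr_sum big_mkcond /=.
  apply: ler_sum => v _; case: ifP => [/andP[]|_]; last exact: ler0n.
  exact: block_graph_sqr_le.
rewrite ler_nat.
under eq_bigr do rewrite !big_split /=.
rewrite !big_split /=.
have links : (\sum_(u < n) \sum_(v < n)
    (v == u.+1 :> nat) * (width r u.+1 - width r u) <= width r n - width r 0)%N.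
  apply: (@leq_trans (\sum_(u < n) (width r u.+1 - width r u))%N).
    by apply: leq_sum => u _; exact: (sum_delta_le n u.+1 (fun=> _)).
  elim: (n) => [|k IHk]; first by rewrite big_ord0.
  rewrite big_ord_recr /=; have := width_le r 0%N k isT; have := width_le r k k.+1 (leqnSn k).
  move=> wk w0k; apply: leq_trans (leq_add IHk (leqnn _)) _; lia.
have start : (\sum_(u < n) \sum_(v < n) (u == 0%N :> nat) * block_graph u v <= 2)%N.
  rewrite -w0; apply: leq_trans (sum_delta_le n 0%N (width r)).
  by apply: leq_sum => u _; rewrite -big_distrr /= -deg_sum leq_mul2l degw orbT.
have stop : (\sum_(u < n) \sum_(v < n) (v == n.-1 :> nat) * block_graph v u <=
    width r n.-1)%N.
  rewrite exchange_big /=; apply: leq_trans (sum_delta_le n n.-1 (width r)).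
  by apply: leq_sum => u _; rewrite -big_distrr /= -deg_sum leq_mul2l degw orbT.
(* Position [n], just past the graph, would open the block [K.+1]. *)
have wn : width r n = (K + 4)%N.
  rewrite /width ltnNge leq_addr /= /n addKn (@block_unique K.+1); first by lia.
  by rewrite leqnn (block_startS K.+1); lia.
have := width_le r n.-1 n (leq_pred n).
rewrite wn => wn1; apply: leq_trans (leq_add (leq_add links start) stop) _.
by rewrite wn w0; lia.
Qed.

(** Keeps only the pairs of a path vertex, of degree at most 2, and a vertex of block [a] or later,
    of degree at least [a + 2]. *)
Lemma sigma_t_block_graph_ge (R : realType) (a : nat) :
  (a ^ 2 * (r * (block_start K.+1 - block_start a)))%N%:R <= sigma_t R block_graph.
Proof.
have degE := block_graph_deg.
have := sum_interval n 0%N r; have := sum_interval n (r + block_start a)%N n.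
rewrite minnn minn0 subn0 => hiE loE.
apply: (@le_trans _ _ ((\sum_(u < n) \sum_(v < n)
   (0 <= u < r) * ((r + block_start a <= v < n) * a ^ 2))%N%:R)).
  rewrite ler_nat; under [leqRHS]eq_bigr do rewrite -big_distrr -big_distrl /=.
  rewrite -big_distrl /= hiE loE {2 3}/n.
  have -> : minn n r = r by apply/minn_idPr; rewrite leq_addr.
  by rewrite /n; lia.
rewrite natr_sum; apply: ler_sum => u _; rewrite natr_sum [leRHS]big_mkcond /=.
apply: ler_sum => v _; rewrite ltn_ord andbT.
have [ur|ur] := ltnP u r; last by case: ifP => // _; apply: sqr_ge0.
have [rv|rv] := leqP (r + block_start a) v; last by case: ifP => // _; apply: sqr_ge0.
rewrite !mul1n; have -> : (u < v)%N by lia.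
have du : (deg block_graph u <= 2)%N.
  by have := degE u; rewrite [width r u]/width ur; lia.
have dv : (a + 2 <= deg block_graph v)%N.
  have := degE v; rewrite [width r v]/width; have -> : (v < r)%N = false by lia.
  have := blockP (v - r); case: (leqP a (block (v - r))) => [|/ltn_block_start]; last first.
    by rewrite block_startS; lia.
  by lia.
rewrite natrX -[leRHS]sqrrN opprB ler_pXn2r ?nnegrE //.
  by rewrite lerBrDr -natrD ler_nat; lia.
by rewrite subr_ge0 ler_nat; lia.
Qed.

End BlockGraph.

(** * Choice of the parameters for a given order *)

Lemma sigma_t_ge_block_graph (R : realType) (n : nat) : (18 <= n)%N ->
  exists e : rel 'I_n,
    [/\ simple_graph e, connected_graph e, 0 < sigma R e &
        (99 * 144)^-1 * pow52 R n * sigma R e <= sigma_t R e].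
Proof.
move=> n18.
(* For the largest [a] with [18 * a ^ 2 <= n], maximality gives
   [n < 18 * (a + 1) ^ 2 <= 72 * a ^ 2]. *)
have [a [a0 an na]] : exists a, [/\ 0 < a, 18 * a ^ 2 <= n & n <= 72 * a ^ 2]%N.
  have ex : exists a, (18 * a ^ 2 <= n)%N by exists 1%N.
  have bd a : (18 * a ^ 2 <= n)%N -> (a <= n)%N by nia.
  have [a an amax] := ex_maxnP ex bd; exists a.
  have a0 : (0 < a)%N by apply: amax.
  split=> //; rewrite leqNgt; apply/negP => na.
  by have := amax a.+1; rewrite ltnn => h; apply: notF; apply: h; nia.
(* The [2 * a] blocks occupy [2 * a ^ 2 + 7 * a <= 9 * a ^ 2 <= n / 2] vertices, which leaves half
   for the path; those from block [a] on hold at least [a ^ 2]. *)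
have [K Ka] : exists K, K.+1 = a.*2 by exists a.*2.-1; lia.
have startK : (block_start K.+1 = 2 * a ^ 2 + 7 * a)%N.
  by have := block_startE K.+1; rewrite Ka; lia.
have starta : (2 * block_start a = a ^ 2 + 7 * a)%N by rewrite block_startE; lia.
have aa : (a <= a ^ 2)%N by nia.
have [r [r2 rn nE]] : exists r, [/\ 2 <= r, n <= 2 * r & n = r + block_start K.+1]%N.
  by exists (n - block_start K.+1)%N; rewrite startK; split; lia.
subst n; set n := (r + _)%N in n18 an na rn *.
have simple := @block_graph_simple r K r2; have conn := @block_graph_connected r K r2.
have upper := @sigma_block_graph_le r K r2 R.
have lower := @sigma_t_block_graph_ge r K r2 R a.
(* [144 = 2 * 72], from [n <= 2 * r] and [n <= 72 * a ^ 2]. *)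
have count : (n ^ 2 * a ^ 2 <=
    144 * (a ^ 2 * (r * (block_start K.+1 - block_start a))))%N.
  have gap : (a ^ 2 <= block_start K.+1 - block_start a)%N by rewrite startK; lia.
  apply: (@leq_trans (144 * (a ^ 2 * (r * a ^ 2)))%N); last by rewrite !leq_mul2l gap !orbT.
  have : (n * n <= 2 * r * (72 * a ^ 2))%N by apply: leq_mul.
  by move: (n) (a ^ 2)%N => k b; nia.
have st0 : 0 < sigma_t R (@block_graph r K).
  apply: lt_le_trans lower; rewrite ltr0n.
  suff : (0 < n ^ 2 * a ^ 2)%N by lia.
  by rewrite muln_gt0 !expn_gt0 a0 (leq_trans _ n18).
(* If [sigma] vanished, the upper bound would make [sigma_t] vanish too. *)
have s0 : 0 < sigma R (@block_graph r K).
  rewrite lt_neqAle sigma_ge0 andbT eq_sym; apply/eqP => s0.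
  by move: (sigma_t_le R _ _ simple conn); rewrite s0 mulr0 leNgt st0.
exists block_graph; split => //.
(* Here [2 * K + 9 = 4 * a + 7 <= 11 * a]; together with the bound [9 * a] on the square root of
   [n], this yields the factor [99]. *)
have sA : sigma R (@block_graph r K) <= 11 * a%:R.
  by apply: le_trans upper _; rewrite -natrM ler_nat; lia.
have qA : Num.sqrt n%:R <= 9 * a%:R :> R.
  rewrite -(@ler_pXn2r _ 2) ?nnegrE ?sqrtr_ge0 ?mulr_ge0 // sqr_sqrtr //.
  by rewrite -natrM -natrX ler_nat expnMn; apply: leq_trans na _; rewrite leq_mul2r orbT.
have qs : Num.sqrt n%:R * sigma R (@block_graph r K) <= 99 * a%:R ^+ 2.
  have -> : 99 * a%:R ^+ 2 = (9 * a%:R) * (11 * a%:R) :> R by ring.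
  by apply: ler_pM; rewrite ?sqrtr_ge0 ?sigma_ge0.
have nqs := ler_wpM2l (sqr_ge0 (n%:R : R)) qs.
have {}lower := le_trans _ (ler_wpM2l (ler0n R 144) lower).
move: count; rewrite -(ler_nat R) [leRHS]natrM => /lower.
rewrite natrM !natrX => count.
rewrite -mulrA ler_pdivrMl ?mulr_gt0 // /pow52; lra.
Qed.

Theorem theorem3 (R : realType) :
  (* upper bound: sigma_t(G) <= sqrt(1.5) n^{5/2} sigma(G) for every connected graph *)
  (forall (n : nat) (e : rel 'I_n),
      simple_graph e -> connected_graph e ->
      sigma_t R e <= Num.sqrt (3 / 2) * pow52 R n * sigma R e)
  /\
  (* lower bound: f(n) = Omega(n^{5/2}) *)
  (exists c : R, 0 < c /\ exists N : nat, forall n : nat, (N <= n)%N ->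
      exists e : rel 'I_n,
        [/\ simple_graph e, connected_graph e, 0 < sigma R e &
            c * pow52 R n * sigma R e <= sigma_t R e]).
Proof.
split; first exact: sigma_t_le.
exists (99 * 144)^-1; split; first by rewrite invr_gt0 mulr_gt0.
by exists 18%N => n n18; apply: sigma_t_ge_block_graph.
Qed.
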